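(* Let $A\in\mathbb{R}^{n\times n}$ be strictly stable, and let $\mathcal{R}\subseteq\mathbb{R}^n$ be a closed convex set with nonempty interior such that $\mathcal{R}=\bigcap_{i=1}^N \mathcal{E}_i$ and $\mathcal{R}\subseteq\mathrm{conv}(\mathcal{F}_1\cup\dots\cup\mathcal{F}_M)$, where each $\mathcal{E}_i$ is an ellipsoid, each $\mathcal{F}_i$ is an ellipsoid or a singleton, and $E_1,\ldots,E_N,F_1,\ldots,F_M$ are convex quadratic functions on $\mathbb{R}^n$ with $\mathcal{E}_i=\{x: E_i(x)\le 0\}$ for $i=1,\dots,N$ and $\mathcal{F}_i=\{x: F_i(x)\le 0\}$ for $i=1,\dots,M$. Assume $0\notin\mathcal{R}$. Let $V$ be a convex quadratic function on $\mathbb{R}^n$, let $\lambda_1,\ldots,\lambda_M\ge0$, $\mu_1,\ldots,\mu_N\ge0$, $\nu_1,\ldots,\nu_N\ge0$ and $r\in\mathbb{R}$ be scalars, and suppose that for all $x\in\mathbb{R}^n$: \begin{align*} &V(x)\le 1+\lambda_iF_i(x)\quad\text{for all } i\in\{1,\dots,M\},\\ &V(x)\ge r-\sum_{i=1}^N\mu_iE_i(x),\\ &\mathcal{L}_AV(x)\le g(x)+\sum_{i=1}^N\nu_iE_i(x), \end{align*} where $g$ is one of the two functions specified below. (1) If $g(x)=-1$ for all $x$, then for every $x_0\in\mathcal{R}$, $$t_*(x_0,\mathcal{R};A)\le\max(V(x_0)-r,0)\le\max(1-r,0).$$ (2) If $g(x)=-2\gamma V(x)$ for all $x$, for some fixed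 $\gamma>0$, and if $r>0$, then for every $x_0\in\mathcal{R}$, $$t_*(x_0,\mathcal{R};A)\le\frac{\log^+\big(\frac{V(x_0)}{r}\big)}{2\gamma}\le\frac{\log^+\big(\frac1r\big)}{2\gamma},$$ where $\log^+(\alpha)=\log(\max(\alpha,1))$.
   Context: A matrix $A$ is strictly stable if all its eigenvalues have negative real part. A quadratic function on $\mathbb{R}^n$ is a function of the form $V(x)=x^\top Qx+2b^\top x+c$ with $Q=Q^\top\in\mathbb{R}^{n\times n}$, $b\in\mathbb{R}^n$, $c\in\mathbb{R}$; it is convex if $Q\succeq0$ (so $Q$ may be singular or zero). ''Ellipsoid'' is understood in the broad sense: a set of the form $\{x\in\mathbb{R}^n: V(x)\le0\}$ with $V$ a convex quadratic function, possibly degenerate (unbounded in some directions), but always closed and with nonempty interior. For a quadratic function $V$, the Lie derivative along $x\mapsto Ax$ is $\mathcal{L}_AV(x)=V'(x)Ax$, i.e. $\mathcal{L}_AV(x)=x^\top(A^\top Q+QA)x+2b^\top Ax$. Escaping time: for $x_0\in\mathcal{R}$, let $\xi(t,x_0)=e^{tA}x_0$ be the solution of $\dot x=Ax$ with $x(0)=x_0$. Then $t_*(x_0,\mathcal{R};A)=\min\{t\ge0:\xi(t,x_0)\in\mathrm{bd}\,\mathcal{R}\}$, with the convention that $t_*(x_0,\mathcal{R};A)=0$ if $\xi(t,x_0)\in\mathrm{int}\,\mathcal{R}$ for all $t\ge0$. Here $\mathrm{bd}$ and $\mathrm{int}$ denote topological boundary and interior. *)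

(* Defs.v *)
From HB Require Import structures.
From mathcomp Require Import all_boot all_order all_algebra complex.
From mathcomp Require Import all_classical all_reals all_analysis.

Set Implicit Arguments.
Unset Strict Implicit.
Unset Printing Implicit Defensive.

Import Order.TTheory GRing.Theory Num.Theory.
Import numFieldNormedType.Exports.

Local Open Scope classical_set_scope.
Local Open Scope ring_scope.

Section definitions.
Context {R : realType} {n : nat}.
Implicit Types (A Q : 'M[R]_n) (S : set 'cV[R]_n) (V : 'cV[R]_n -> R).

(* The spectrum is taken in [R[i]]. *)
Definition strictly_stable A :=
  forall z : R[i],
    eigenvalue (map_mx (real_complex R) A) z -> complex.Re z < 0.

Definition psdmx Q := forall x : 'cV[R]_n, 0 <= (x^T *m Q *m x) 0 0.

Definition convex_quadratic V :=
  exists (Q : 'M[R]_n) (b : 'cV[R]_n) (c : R),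
    [/\ Q^T = Q, psdmx Q &
        forall x, V x = (x^T *m Q *m x) 0 0 + 2 * (b^T *m x) 0 0 + c].

(* Closedness is automatic for sublevel sets of quadratic functions. *)
Definition ellipsoid S :=
  (exists2 V, convex_quadratic V & S = [set x | V x <= 0]) /\ S° !=set0.

Definition convex_hull S : set 'cV[R]_n := smallest (@convex_set R 'cV[R]_n) S.

Definition frontier S := closure S `\` S°.

Definition Lie_derivative A V (x : 'cV[R]_n) : R := 'd V x (A *m x).

Definition expmx A : 'M[R]_n :=
  limn (series (fun k => (k`!%:R)^-1 *: A ^+ k)).

Definition flow A (t : R) (x0 : 'cV[R]_n) : 'cV[R]_n := expmx (t *: A) *m x0.

(* [is_escaping_time A S x0 t] says that [t] is the value of the escaping time
   of [x0]: either the attained minimum of the hitting times of the frontier,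
   or, by convention, 0 when the trajectory stays in the interior forever.
   The value is unique by [is_escaping_time_unique]. *)
Definition is_escaping_time A S (x0 : 'cV[R]_n) (t : R) :=
  [/\ 0 <= t, frontier S (flow A t x0) &
      forall s, 0 <= s -> frontier S (flow A s x0) -> t <= s]
  \/ ((forall s, 0 <= s -> S° (flow A s x0)) /\ t = 0).

Lemma is_escaping_time_unique A S x0 t1 t2 :
  is_escaping_time A S x0 t1 -> is_escaping_time A S x0 t2 -> t1 = t2.
Proof.
move=> [[t1_ge0 [Ft1 S't1] t1_min]|[inS ->]] [[t2_ge0 [Ft2 S't2] t2_min]|[inS2 ->]].
- apply/le_anti/andP; split; first exact: t1_min.
  exact: t2_min.
- by case: (S't1 (inS2 _ t1_ge0)).
- by case: (S't2 (inS _ t2_ge0)).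
- by [].
Qed.

Definition lnp (a : R) : R := ln (Num.max a 1).

End definitions.

(* Main.v *)
(* On R each E_i is nonpositive, so V >= r and L_A V <= g there; V <= 1 on each
   F_i, hence on their convex hull by convexity of V, hence on R. While the
   trajectory xi stays in R, the function V(xi(t)) + t in case (1), and
   exp(2 gamma t) V(xi(t)) in case (2), is nonincreasing, and V(xi(t)) >= r bounds
   the time spent in R. In particular the trajectory cannot remain in R forever,
   so it hits the boundary, and the first hitting time obeys the same bound. *)
Require Import Defs.
From HB Require Import structures.
From mathcomp Require Import all_boot all_order all_algebra.
From mathcomp Require Import ring lra.
From mathcomp Require Import all_classical all_reals all_analysis.
Set Implicit Arguments.
Unset Strict Implicit.
Unset Printing Implicit Defensive.
Import Order.TTheory GRing.Theory Num.Theory.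
Import numFieldNormedType.Exports.
Local Open Scope classical_set_scope.
Local Open Scope ring_scope.

(** * Auxiliary facts on limits, monotonicity and truncated logarithms *)

(** The matrix norm is a maximum over finitely many entries, so the entrywise neighbourhoods can be
    intersected. *)
Lemma cvg_mx (R : realFieldType) (T : Type) (G : set_system T) m n
    (f : T -> 'M[R]_(m, n)) (l : 'M[R]_(m, n)) : Filter G ->
  (forall i j, (fun x => f x i j) @ G --> l i j) -> f @ G --> l.
Proof.
move=> FG fl; apply/cvgrPdist_le => /= e e0.
near=> x.
rewrite /Num.Def.normr/= mx_normrE (bigmax_le _ (ltW e0))//= => i _.
rewrite !mxE/=.
move: i; near: x; apply: filter_forall => /= i.
exact: ((cvgrPdist_le _ _).1 (fl i.1 i.2)).
Unshelve. all: by end_near. Qed.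

Lemma cvg_sumr (R : realFieldType) (T : Type) (G : set_system T) (n : nat)
    (f : 'I_n -> T -> R) (l : 'I_n -> R) : Filter G ->
  (forall i, f i x @[x --> G] --> l i) ->
  \sum_(i < n) f i x @[x --> G] --> \sum_(i < n) l i.
Proof. by move=> FG fl; apply: cvg_big => //; exact: add_continuous. Qed.

Lemma is_derive_le0_le (R : realType) (f f' : R -> R) (t : R) :
  (forall s : R, is_derive s (1 : R) f (f' s)) -> 0 <= t ->
  (forall s, 0 <= s <= t -> f' s <= 0) -> f t <= f 0.
Proof.
move=> df t0 f'le0.
have cf : continuous f.
  move=> s; apply/differentiable_continuous/derivable1_diffP.
  by have [ds _] := df s; exact: ds.
apply: (@ler0_derive1_le_cc _ f 0 t) => //.
- move=> s; rewrite in_itv/= => /andP[s0 st].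
  by rewrite derive1E; have [_ ->] := df s; rewrite f'le0// !ltW.
- by apply: continuous_subspaceT.
- by rewrite in_itv/= lexx t0.
- by rewrite in_itv/= lexx t0.
Qed.

(** With [k = 2 * gamma] this is the integrating factor of the exponential decay case. *)
Lemma is_derive_expR_scaled (R : realType) (k s : R) :
  is_derive s (1 : R) (fun u => expR (k * u)) (k * expR (k * s)).
Proof.
have dk : is_derive s (1 : R) ( *%R k) k.
  by apply: (is_derive_eq (is_deriveZ k (is_derive_id s 1))); rewrite [LHS]mulr1.
by rewrite mulrC; apply: is_derive1_comp.
Qed.

(** The truncation at 1 keeps both arguments of [ln] positive. *)
Lemma le_lnp (R : realType) (a b : R) : a <= b -> lnp a <= lnp b.
Proof.
move=> ab; rewrite /lnp ler_ln ?posrE ?lt_max ?ltr01 ?orbT//.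
by rewrite ge_max !le_max ab lexx orbT.
Qed.

(** * The matrix exponential and the flow it generates *)

Section matrix_exponential.
Context {R : realType} {n : nat}.
Implicit Types (A : 'M[R]_n) (x : 'cV[R]_n).

(** The sum of all [|A i j|] dominates every row sum, so each further factor [A] costs at most one
    factor of it. *)
Lemma normr_exprmx_le A k i j :
  `|(A ^+ k) i j| <= (\sum_i \sum_j `|A i j|) ^+ k.
Proof.
set C := \sum_i _.
have C_ge0 : 0 <= C by apply: sumr_ge0 => ? _; apply: sumr_ge0.
elim: k i j => [|k IH] i j.
  rewrite !expr0 mxE; case: (i == j) => /=; rewrite ?normr1 ?normr0//.
have -> : (A ^+ k.+1) i j = \sum_l A i l * (A ^+ k) l j.
  by rewrite exprS mxE.
apply: (le_trans (ler_norm_sum _ _ _)).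
apply: (@le_trans _ _ (\sum_l `|A i l| * C ^+ k)).
  by apply: ler_sum => l _; rewrite normrM ler_wpM2l.
rewrite -mulr_suml exprS ler_wpM2r ?exprn_ge0//.
rewrite [leRHS](bigD1 i)//= lerDl; apply: sumr_ge0 => ? _; exact: sumr_ge0.
Qed.

(* Shifting the power of [A] by [p] makes this family closed under termwise
   differentiation of power series. *)
Definition expmx_coef A p i j : R^nat :=
  fun k => (k`!%:R)^-1 * (A ^+ (k + p)) i j.

(** Absolute convergence by comparison with [C ^+ p] times the scalar exponential series at
    [C * |t|]. *)
Lemma is_cvg_pseries_expmx_coef A p i j (t : R) :
  cvgn (pseries (expmx_coef A p i j) t).
Proof.
set C := \sum_i \sum_j `|A i j|.
have C_ge0 : 0 <= C by apply: sumr_ge0 => ? _; apply: sumr_ge0.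
apply: normed_cvg.
apply: (@series_le_cvg _ _
  (fun k => C ^+ p * exp_coeff (C * `|t|) k)) => //.
- by move=> k /=.
- move=> k; rewrite /exp_coeff/=.
  by rewrite !(mulr_ge0, invr_ge0, exprn_ge0).
- move=> k; rewrite /exp_coeff/= /expmx_coef.
  rewrite !normrM normrX normfV (@ger0_norm _ k`!%:R)//.
  rewrite [leRHS](_ : _ = k`!%:R^-1 * C ^+ (k + p) * `|t| ^+ k).
    by rewrite ler_wpM2r ?exprn_ge0// ler_wpM2l ?invr_ge0// normr_exprmx_le.
  by rewrite exprMn exprD; ring.
- exact: (is_cvg_seriesZ (is_cvg_series_exp_coeff _)).
Qed.

Lemma pseries_diffs_expmx_coef A p i j :
  pseries_diffs (expmx_coef A p i j) = expmx_coef A p.+1 i j.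
Proof.
apply/funext => k; rewrite /pseries_diffs /expmx_coef addSnnS factS natrM invfM.
by rewrite !mulrA mulfV ?mul1r// pnatr_eq0.
Qed.

Lemma exprmxZ A (t : R) k : (t *: A) ^+ k = t ^+ k *: A ^+ k.
Proof.
elim: k => [|k IH]; first by rewrite !expr0 scale1r.
by rewrite !exprS IH -[LHS]/((t *: A) *m (t ^+ k *: A ^+ k)) -scalemxAl -scalemxAr scalerA.
Qed.

(** Reduces the matrix exponential to scalar power series in [t], which can be differentiated
    termwise. *)
Lemma expmxE A (t : R) i j :
  expmx (t *: A) i j = limn (pseries (expmx_coef A 0 i j) t).
Proof.
pose L := \matrix_(i, j) limn (pseries (expmx_coef A 0 i j) t).
suff -> : expmx (t *: A) = L by rewrite mxE.
apply: cvg_lim => //; apply: cvg_mx => {}i {}j; rewrite mxE.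
rewrite [X in X @ _](_ : _ = pseries (expmx_coef A 0 i j) t).
  exact: is_cvg_pseries_expmx_coef.
apply/funext => m; rewrite /series/= summxE; apply: eq_bigr => k _.
rewrite exprmxZ !mxE /expmx_coef /= addn0; ring.
Qed.

Lemma is_derive_expmx A (t : R) i j :
  is_derive t (1 : R) (fun s => expmx (s *: A) i j) ((A *m expmx (t *: A)) i j).
Proof.
under eq_fun do rewrite expmxE.
rewrite (_ : (A *m _) i j = limn (pseries (expmx_coef A 1 i j) t)).
  rewrite -pseries_diffs_expmx_coef.
  (* Any radius beyond [|t|] would do. The series and its first two formal derivatives must converge
     there; they are the families with [p] equal to 0, 1 and 2. *)
  apply: (@pseries_snd_diffs _ _ (`|t| + 1));
    rewrite ?pseries_diffs_expmx_coef; try exact: is_cvg_pseries_expmx_coef.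
  by rewrite [ltRHS]ger0_norm ?addr_ge0// ltrDl.
(* Since [A ^+ k.+1 = A * A ^+ k], the series with shift 1 is a finite combination of those with
   shift 0, with coefficients [A i l]. *)
apply/esym/cvg_lim => //; rewrite mxE.
rewrite [X in X @ _](_ : _ =
    fun m => \sum_l A i l * pseries (expmx_coef A 0 l j) t m).
  apply: cvg_sumr => l; rewrite expmxE; apply: cvgMr.
  exact: is_cvg_pseries_expmx_coef.
apply/funext => m; under eq_bigr do rewrite /pseries /series/= mulr_sumr.
rewrite exchange_big; apply: eq_bigr => k _ /=.
rewrite /expmx_coef addn1 addn0.
have -> : (A ^+ k.+1) i j = \sum_l A i l * (A ^+ k) l j.
  by rewrite exprS mxE.
by rewrite mulr_sumr mulr_suml; apply: eq_bigr => l _; ring.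
Qed.

Lemma flow0 A x : flow A 0 x = x.
Proof.
rewrite /flow; suff -> : expmx (0 *: A) = 1%:M by rewrite mul1mx.
apply/cvg_lim => //; apply: cvg_near_cst; near=> m.
(* The empty partial sum is 0, so the partial sums equal the identity only from index 1 on. *)
have [k ->] : exists k, m = k.+1.
  by exists m.-1; rewrite prednK//; near: m; exists 1%N.
rewrite /series/= big_nat_recl//= fact0 invr1 scale1r expr0 big1 ?addr0//.
by move=> l _; rewrite scale0r exprS mul0r scaler0.
Unshelve. all: by end_near. Qed.

Lemma is_derive_flow A x (t : R) :
  is_derive t (1 : R) (fun s => flow A s x) (A *m flow A t x).
Proof.
have D i : is_derive t (1 : R) (fun s => flow A s x i 0)
    ((A *m flow A t x) i 0).
  have -> : (fun s => flow A s x i 0) =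
      \sum_j (fun s => x j 0 *: expmx (s *: A) i j).
    apply/funext => s; rewrite fct_sumE mxE.
    by apply: eq_bigr => j _; rewrite mulrC.
  have -> : (A *m flow A t x) i 0 =
      \sum_j x j 0 *: (A *m expmx (t *: A)) i j.
    by rewrite mulmxA mxE; apply: eq_bigr => j _; rewrite mulrC.
  apply: is_derive_sum => j; apply: is_deriveZ; exact: is_derive_expmx.
have df : derivable (fun s => flow A s x) t 1.
  by apply/derivable_mxP => i j; rewrite ord1; have [] := D i.
apply: DeriveDef => //; rewrite derive_mx//; apply/matrixP => i j.
by rewrite ord1 mxE; have [_ ->] := D i.
Qed.

Lemma flow_continuous A x : continuous (flow A ^~ x).
Proof.
move=> t; apply: differentiable_continuous; apply/derivable1_diffP.
by have [] := is_derive_flow A x t.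
Qed.

End matrix_exponential.

(** * Convex quadratic functions and their derivative along the flow *)

Section quadratic.
Context {R : realType} {n : nat}.
Implicit Types (A : 'M[R]_n) (x : 'cV[R]_n) (V : 'cV[R]_n -> R).

Lemma convex_quadratic_differentiable V x :
  convex_quadratic V -> differentiable V x.
Proof.
move=> [Q [b [c [_ _ VE]]]].
(* [f i y] is the [i]-th entry of [y^T *m Q]; it makes [V] a sum of products of coordinate
   functions. *)
pose f i (y : 'cV[R]_n) : R := \sum_j y j 0 * Q j i.
have -> : V = \sum_i (f i * (fun y : 'cV[R]_n => y i 0)) +
    \sum_i (fun y : 'cV[R]_n => (2 * b i 0) *: y i 0) + cst c.
  apply/funext => y; rewrite VE /GRing.add/=; congr (_ + _ + _).
    rewrite mxE fct_sumE; apply: eq_bigr => i _.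
    by rewrite mxE /f/=; congr (_ * _); apply: eq_bigr => j _; rewrite mxE.
  rewrite mxE mulr_sumr fct_sumE; apply: eq_bigr => i _.
  by rewrite mxE mulrA.
apply: differentiableD => //; apply: differentiableD.
  apply: differentiable_sum => i; apply: differentiableM.
    rewrite (_ : f i = \sum_j (fun y : 'cV[R]_n => Q j i *: y j 0)).
      apply: differentiable_sum => j; apply: differentiableZ.
      exact: differentiable_coord.
    by apply/funext => y; rewrite fct_sumE; apply: eq_bigr => j _; rewrite mulrC.
  exact: differentiable_coord.
apply: differentiable_sum => i; apply: differentiableZ.
exact: differentiable_coord.
Qed.

(** For [z = l x + (1 - l) y], the defect [l V(x) + (1 - l) V(y) - V(z)] equals [l (1 - l)] times
    the quadratic form at [x - y], hence is nonnegative. *)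
Lemma convex_quadratic_sublevel V c :
  convex_quadratic V -> convex_set [set x | V x <= c].
Proof.
move=> [Q [b [d [QT Qpsd VE]]]] x y l; rewrite !inE/= => Vx Vy.
have : 0 <= (l%:num : R) <= 1 by apply/andP.
have -> : conv l x y = l%:num *: (x : 'cV_n) + (1 - l%:num) *: (y : 'cV_n).
  by [].
move: (l%:num : R) => {}l /andP[l0 l1].
pose q (u v : 'cV[R]_n) := (u^T *m Q *m v) 0 0.
have qC u v : q u v = q v u.
  rewrite /q -[in LHS](trmxK (u^T *m Q *m v)) mxE !trmx_mul trmxK QT.
  by rewrite mulmxA.
have qDr a k u v w : q w (a *: u + k *: v) = a * q w u + k * q w v.
  by rewrite /q mulmxDr -!scalemxAr [LHS]mxE; congr (_ + _); exact: mxE.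
have qDl a k u v w : q (a *: u + k *: v) w = a * q u w + k * q v w.
  by rewrite !(qC _ w) qDr.
have bD a k u v : (b^T *m (a *: u + k *: v)) 0 0 =
    a * (b^T *m u) 0 0 + k * (b^T *m v) 0 0.
  by rewrite mulmxDr -!scalemxAr [LHS]mxE; congr (_ + _); exact: mxE.
(* The difference [x - y] is written as a linear combination so that [qDl] and [qDr] expand it. *)
have := Qpsd (1 *: x + (-1) *: y).
rewrite -/(q _ _) qDl !qDr (qC y x).
move: Vx Vy; rewrite !VE bD -!/(q _ _) qDl !qDr (qC y x).
move: (q x x) (q x y) (q y y) ((b^T *m x) 0 0) ((b^T *m y) 0 0).
move=> qxx qxy qyy bx by' Vx Vy Qxy.
have : 0 <= l * (1 - l) * (qxx - 2 * qxy + qyy).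
  by apply: mulr_ge0; [apply: mulr_ge0; lra | lra].
have := ler_wpM2l l0 Vx.
have l2 : 0 <= 1 - l by lra.
have := ler_wpM2l l2 Vy.
lra.
Qed.

Lemma is_derive_quadratic_flow A V x (t : R) : convex_quadratic V ->
  is_derive t (1 : R) (fun s => V (flow A s x))
    (Lie_derivative A V (flow A t x)).
Proof.
move=> cV; have [dF FE] := is_derive_flow A x t.
have dV := convex_quadratic_differentiable (flow A t x) cV.
move/derivable1_diffP : dF => dF.
have dVF : differentiable (V \o (fun s => flow A s x)) t.
  exact: differentiable_comp.
apply: DeriveDef; first exact/derivable1_diffP.
by rewrite deriveE// diff_comp//= /Lie_derivative -FE deriveE.
Qed.

Lemma convex_hull_sub (S T : set 'cV[R]_n) :
  convex_set T -> S `<=` T -> convex_hull S `<=` T.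
Proof. by move=> cT ST x; apply. Qed.

End quadratic.

(** * First hitting of the frontier by a continuous path *)

Section first_exit.
Context {R : realType} {n : nat}.
Variables (S : set 'cV[R]_n) (f : R -> 'cV[R]_n).
Hypotheses (clS : closed S) (cf : continuous f) (Sf0 : S (f 0)).

(* As long as the path avoids the frontier, its preimages of [S] and of [S°]
   coincide, so they are clopen in the connected segment [0, t]. *)
Lemma stay_in t :
  (forall s, 0 <= s <= t -> ~ frontier S (f s)) ->
  forall s, 0 <= s <= t -> S (f s).
Proof.
move=> nF s /andP[s0 st].
have inS u : 0 <= u <= t -> S (f u) -> S° (f u).
  move=> ut Su; apply: contrapT => nSu; apply: (nF u ut).
  by split=> //; exact: subset_closure.
have conn : connected (f @` `[0, t]).
  apply: connected_continuous_connected; first exact: segment_connected.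
  exact: continuous_subspaceT.
have t0 : 0 <= t := le_trans s0 st.
suff E : f @` `[0, t] `&` S = f @` `[0, t].
  suff [] : (f @` `[0, t] `&` S) (f s) by [].
  by rewrite E; exists s => //=; rewrite in_itv/= s0.
apply: conn.
- by exists (f 0); split=> //; exists 0 => //=; rewrite in_itv/= lexx.
- exists S°; first exact: open_interior.
  apply/seteqP; split=> [y [[u/= ut <-] Su]|y [[u/= ut <-] Su]].
    by split; [exists u|apply: inS => //; rewrite in_itv in ut].
  by split; [exists u|exact: interior_subset].
- by exists S.
Qed.

(** The hitting times form a closed set bounded below, so once it is nonempty its infimum is
    attained. Both nonemptiness and the bound come from applying the hypothesis to a time exceeding
    [b] before which the frontier is not met. *)
Lemma escaping_time_exists b :
  (forall t, 0 <= t -> (forall s, 0 <= s <= t -> S (f s)) -> t <= b) ->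
  exists2 t, [/\ 0 <= t, frontier S (f t) &
    forall s, 0 <= s -> frontier S (f s) -> t <= s] & t <= b.
Proof.
move=> bnd.
have b0 : 0 <= b.
  by apply: bnd => // s; rewrite -eq_le => /eqP <-.
pose H := [set s : R | 0 <= s /\ frontier S (f s)].
have H0 : H !=set0.
  apply: contrapT => nH.
  have : b + 1 <= b.
    apply: bnd; first by rewrite addr_ge0.
    by apply: stay_in => s /andP[s0 _] Fs; apply: nH; exists s.
  by rewrite gerDl ler10.
have lbH : has_lbound H by exists 0 => s [].
have clH : closed H.
  have -> : H = [set s | 0 <= s] `&` (f @^-1` S `&` f @^-1` (~` S°)).
    by rewrite /H /frontier -(closure_id S).1.
  apply: closedI; first exact: closed_ge.
  apply: closedI; apply: preimage_closed => //.
  exact: open_closedC (open_interior _).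
have Hm : H (inf H).
  suff : closure H (inf H) by rewrite -(closure_id H).1.
  move=> B /nbhs_ballP[e /= e0 eB].
  have [s Hs se] := inf_adherent e0 (conj H0 lbH).
  exists s; split=> //; apply: eB; rewrite /ball/= ler0_norm.
      by rewrite opprB ltrBlDl.
  by rewrite subr_le0 ge_inf.
exists (inf H); first by case: Hm => ? ?; split=> // s s0 Fs; exact: ge_inf.
rewrite leNgt; apply/negP => bm.
(* The midpoint lies strictly between [b] and [inf H]: the path is still in [S] there, which
   contradicts the bound. *)
have : (b + inf H) / 2 <= b.
  apply: bnd; first by lra.
  apply: stay_in => s /andP[s0 sm] Fs.
  have : inf H <= s by exact: ge_inf.
  lra.
lra.
Qed.

End first_exit.

Theorem theorem6 (R : realType) (n N M : nat) (A : 'M[R]_n)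
    (Rs : set 'cV[R]_n)
    (cE : 'I_N -> set 'cV[R]_n) (cF : 'I_M -> set 'cV[R]_n)
    (E : 'I_N -> 'cV[R]_n -> R) (F : 'I_M -> 'cV[R]_n -> R)
    (V : 'cV[R]_n -> R) (lam : 'I_M -> R) (mu nu : 'I_N -> R) (r : R)
    (g : 'cV[R]_n -> R) :
  strictly_stable A ->
  closed Rs -> convex_set Rs -> Rs° !=set0 ->
  Rs = \bigcap_i cE i ->
  Rs `<=` convex_hull (\bigcup_i cF i) ->
  (forall i, ellipsoid (cE i)) ->
  (forall i, ellipsoid (cF i) \/ exists x, cF i = [set x]) ->
  (forall i, convex_quadratic (E i)) ->
  (forall i, convex_quadratic (F i)) ->
  (forall i, cE i = [set x | E i x <= 0]) ->
  (forall i, cF i = [set x | F i x <= 0]) ->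
  ~ Rs 0 ->
  convex_quadratic V ->
  (forall i, 0 <= lam i) -> (forall i, 0 <= mu i) -> (forall i, 0 <= nu i) ->
  (forall x i, V x <= 1 + lam i * F i x) ->
  (forall x, V x >= r - \sum_(i < N) mu i * E i x) ->
  (forall x, Lie_derivative A V x <= g x + \sum_(i < N) nu i * E i x) ->
  ((forall x, g x = -1) ->
   forall x0, Rs x0 ->
   exists2 t, is_escaping_time A Rs x0 t &
     t <= Num.max (V x0 - r) 0 <= Num.max (1 - r) 0)
  /\
  (forall gamma : R, 0 < gamma ->
   (forall x, g x = - 2 * gamma * V x) ->
   0 < r ->
   forall x0, Rs x0 ->
   exists2 t, is_escaping_time A Rs x0 t &
     t <= lnp (V x0 / r) / (2 * gamma) <= lnp (1 / r) / (2 * gamma)).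
Proof.
move=> _ clRs _ _ RsE Rs_hull _ _ _ _ cEE cFE _ V_quad lam0 mu0 nu0.
move=> VF VE LV.
have E_le0 x i : Rs x -> E i x <= 0.
  by rewrite RsE => /(_ i I); rewrite cEE.
have V_le1 x : Rs x -> V x <= 1.
  suff /(_ x) hull_le1 :
      convex_hull (\bigcup_i cF i) `<=` [set x | V x <= 1].
    by move/Rs_hull/hull_le1.
  apply: convex_hull_sub; first exact: convex_quadratic_sublevel.
  move=> y [i _]; rewrite cFE/= => Fy; apply: le_trans (VF y i) _.
  by rewrite gerDl mulr_ge0_le0.
have V_ger x : Rs x -> r <= V x.
  move=> Rx; apply: le_trans (VE x); rewrite lerDl oppr_ge0.
  by apply: sumr_le0 => i _; rewrite mulr_ge0_le0// E_le0.
have LV_le x : Rs x -> Lie_derivative A V x <= g x.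
  move=> Rx; apply: le_trans (LV x) _; rewrite gerDl.
  by apply: sumr_le0 => i _; rewrite mulr_ge0_le0// E_le0.
(* Both cases reduce to bounding the times up to which the trajectory stays in [Rs]; the escaping
   time is then an attained minimum. *)
have escape x0 b : Rs x0 ->
    (forall t, 0 <= t -> (forall s, 0 <= s <= t -> Rs (flow A s x0)) ->
      t <= b) ->
    exists2 t, is_escaping_time A Rs x0 t & t <= b.
  move=> Rx0 bnd.
  have R0 : Rs (flow A 0 x0) by rewrite flow0.
  have [t ? ?] := escaping_time_exists clRs (@flow_continuous _ _ A x0) R0 bnd.
  by exists t => //; left.
split=> [gE x0 Rx0|gamma gamma0 gE r0 x0 Rx0].
  have [|t t_esc tb] := escape x0 (Num.max (V x0 - r) 0) Rx0.
    move=> t t0 stay; rewrite le_max; apply/orP; left.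
    have df (s : R) : is_derive s (1 : R) (fun u => V (flow A u x0) + u)
        (Lie_derivative A V (flow A s x0) + 1).
      by apply: is_deriveD; exact: is_derive_quadratic_flow.
    have := is_derive_le0_le df t0; rewrite flow0 addr0.
    have : r <= V (flow A t x0) by apply/V_ger/stay; rewrite t0 lexx.
    move=> rV /(_ _)/wrap[].
      move=> s /stay /LV_le; rewrite gE; lra.
    lra.
  exists t => //; rewrite tb ge_max !le_max lexx orbT andbT.
  by rewrite lerD2r V_le1.
have [|t t_esc tb] := escape x0 (lnp (V x0 / r) / (2 * gamma)) Rx0.
  move=> t t0 stay.
  (* The derivative is factored so that, for this [g], [LV_le] makes the second factor nonpositive
     on [Rs]. *)
  have df (s : R) : is_derive s (1 : R)
      (fun u => expR (2 * gamma * u) * V (flow A u x0))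
      (expR (2 * gamma * s) *
        (Lie_derivative A V (flow A s x0) + 2 * gamma * V (flow A s x0))).
    apply: (is_derive_eq (is_deriveM (is_derive_expR_scaled (2 * gamma) s)
      (is_derive_quadratic_flow A x0 s V_quad))).
    by rewrite /GRing.scale/=; ring.
  have rV : r <= V (flow A t x0) by apply/V_ger/stay; rewrite t0 lexx.
  have := is_derive_le0_le df t0; rewrite flow0 mulr0 expR0 mul1r.
  move=> /(_ _)/wrap[].
    move=> s /stay /LV_le; rewrite gE => ?.
    by rewrite mulr_ge0_le0 ?expR_ge0//; lra.
  (* After exponentiation the goal is [expR (2 * gamma * t) <= max (V x0 / r) 1]. The first argument
     suffices, because [r] is at most [V] at time [t] and [Vt] bounds the product by [V x0]. *)
  move=> Vt; rewrite ler_pdivlMr ?mulr_gt0// mulrC -ler_expR.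
  rewrite /lnp lnK ?posrE ?lt_max ?ltr01 ?orbT// le_max; apply/orP; left.
  rewrite ler_pdivlMr//; apply: le_trans Vt.
  by rewrite ler_wpM2l ?expR_ge0.
exists t => //; rewrite tb/= ler_wpM2r ?invr_ge0 ?mulr_ge0 ?(ltW gamma0)//.
by apply: le_lnp; rewrite ler_wpM2r ?invr_ge0 ?(ltW r0)// V_le1.
Qed.
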